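(* Let $k \geq 2$, let $n = 2^k - 1$, and let $D$ be a perfect independent dominating set of the hypercube $Q_n$. Then: (1) $Q_n - D$ is $(n-1)$-regular and $(n-1)$-connected. (2) If in addition $D$ is a coset of a linear perfect independent dominating set of $Q_n$, then $Q_n - D$ is Hamiltonian if $k = 2$, and edge-bipancyclic if $k \geq 3$. (3) Moreover, $D$ is a smallest such set: every set $S \subseteq V(Q_n)$ such that $Q_n - S$ is $(n-1)$-regular and $(n-1)$-connected satisfies $|S| \geq |D|$.
   Context: The hypercube $Q_n$ has vertex set $V(Q_n) = \mathbb{F}_2^n$ (binary strings of length $n$), two vertices being adjacent iff they differ in exactly one coordinate; $V(Q_n)$ is regarded as a vector space over $\mathbb{F}_2$. For $S \subseteq V(Q_n)$, $Q_n - S$ is the subgraph induced on $V(Q_n)\setminus S$. A perfect independent dominating set (PID set, or perfect code) of a graph is an independent set $D$ of vertices such that every vertex not in $D$ is adjacent to exactly one vertex of $D$ (and, in $Q_n$ with $n = 2^k-1$, such that any two distinct vertices of $D$ are at distance at least $3$, which is automatic). It is linear if it is a linear subspace of $\mathbb{F}_2^n$; a coset of a linear set $D_0$ is a set $D_0 + x$ with $x \in \mathbb{F}_2^n$. A graph $G$ is edge-bipancyclic if for every edge $e$ of $G$ and every even integer $l$ with $4 \leq l \leq |V(G)|$, there is a cycle of length $l$ in $G$ containing $e$. A graph is Hamiltonian if it has a cycle through all its vertices. *)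

(* Defs.v *)
From HB Require Import structures.
From mathcomp Require Import all_boot all_order all_fingroup all_algebra.

Set Implicit Arguments.
Unset Strict Implicit.
Unset Printing Implicit Defensive.

Import GRing.Theory.

(* A finite simple graph is a finType of vertices together with a symmetric
   irreflexive adjacency relation on it. *)
Section Graph.
Variables (T : finType) (e : rel T).
Implicit Types (D S : {set T}) (c : seq T) (u v : T).

Definition induced_minus S : rel {x : T | x \notin S} := relpre val e.

Definition regular (d : nat) : Prop := forall u, #|[set v | e u v]| = d.

Definition connected : Prop := forall u v, connect e u v.

Definition independent D : Prop := {in D &, forall u v, ~~ e u v}.

Definition PID D : Prop :=
  independent D /\ (forall u, u \notin D -> #|[set v in D | e u v]| = 1).

(* [ucycle] alone also accepts the empty sequence and, since [e] is symmetric,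
   a single edge traversed back and forth. *)
Definition is_cycle c : Prop := 2 < size c /\ ucycle e c.

Definition contains_edge c u v : Prop :=
  [/\ u \in c, v \in c & next c u = v \/ next c v = u].

Definition Hamiltonian : Prop :=
  exists2 c, is_cycle c & forall u, u \in c.

Definition edge_bipancyclic : Prop :=
  forall u v, e u v ->
  forall l, ~~ odd l -> 4 <= l <= #|T| ->
  exists c, [/\ is_cycle c, size c = l & contains_edge c u v].

End Graph.

Arguments induced_minus {T} e S _ _.

Definition k_connected (T : finType) (e : rel T) (d : nat) : Prop :=
  d < #|T| /\ (forall X : {set T}, #|X| < d -> connected (induced_minus e X)).

Definition hypercube (n : nat) : rel 'rV['F_2]_n :=
  fun x y => #|[set i | x ord0 i != y ord0 i]| == 1.

Lemma hypercube_sym n : symmetric (@hypercube n).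
Proof.
by move=> x y; rewrite /hypercube; congr (_ == _); apply: eq_card => i;
   rewrite !inE eq_sym.
Qed.

Lemma hypercube_irr n : irreflexive (@hypercube n).
Proof.
move=> x; rewrite /hypercube (_ : [set _ | _] = set0) ?cards0 //.
by apply/setP => i; rewrite !inE eqxx.
Qed.

Definition hypercube_minus (n : nat) (S : {set 'rV['F_2]_n}) :=
  induced_minus (@hypercube n) S.

Arguments hypercube_minus {n} S _ _.

Definition coset_of_linear_PID (n : nat) (D : {set 'rV['F_2]_n}) : Prop :=
  exists (D0 : {vspace 'rV['F_2]_n}) (x : 'rV['F_2]_n),
    PID (@hypercube n) [set y | y \in D0] /\ D = [set (y + x)%R | y in D0].

(* Main.v *)
(* Part (1): in a perfect code every vertex outside D has exactly one
   neighbour in D.  Delete the vertices of X one at a time: a path through the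
   last deleted vertex x can be rerouted between the two neighbours x + e_i and
   x + e_j of x, because Q_n - D contains n - 1 internally disjoint paths between
   them, at most n - 2 of which are cut by X.  Part (3): a set S as in the
   statement dominates every outside vertex exactly once, so counting edges
   gives |~S| <= n |S|, with equality for D.

   Part (2), k >= 3: an outerplanar quadrangulation, built by gluing
   quadrilaterals along outer edges, that spans Q_n - D and has a given edge
   {x, x + e_d} on its boundary yields cycles of all even lengths through this
   edge, by pruning.  As D is a translate of a linear perfect code, there are
   directions a, b, c, all different from d, with e_a + e_b + e_c in the code.
   Each subcube of directions a, b, c, d then meets D either nowhere or in two
   points that differ by e_a + e_b + e_c, and a finite check provides a spanning
   quadrangulation with two outer edges in direction d, adjacent to each other;
   for every further direction i one of them can be translated by e_i without
   meeting D.  Gluing along such translates doubles the subcube, one direction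
   at a time, until it is the whole of Q_n. *)
Require Import Defs.
From HB Require Import structures.
From mathcomp Require Import all_boot all_order all_fingroup all_algebra.
From mathcomp Require Import zify.

Set Implicit Arguments.
Unset Strict Implicit.
Unset Printing Implicit Defensive.

Import GRing.Theory.

(** * Quadrangulations of a polygon *)

(* A tree rooted at the edge {x, y}: [Node a b l m r] is the quadrilateral
   x, a, b, y whose sides xa, ab, by are the roots of l, m, r. *)
Inductive quad_tree (T : Type) :=
  | Leaf
  | Node of T & T & quad_tree T & quad_tree T & quad_tree T.

Arguments Leaf {T}.

Section QuadTree.
Variables (T : eqType) (e : rel T).
Implicit Types (x y a b p q : T) (t r : quad_tree T).

Fixpoint inner t : seq T :=
  if t is Node a b l m r
  then inner l ++ a :: inner m ++ b :: inner r else [::].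

Fixpoint valid x y t : bool :=
  if t is Node a b l m r
  then [&& e x y, valid x a l, valid a b m & valid b y r] else e x y.

(** The sides of the polygon other than the root, read from x round to y in the same order as
    [inner]; for a lone [Leaf], the root itself. *)
Fixpoint leaves x y t : seq (T * T) :=
  if t is Node a b l m r
  then leaves x a l ++ leaves a b m ++ leaves b y r else [:: (x, y)].

Definition verts x y t := x :: rcons (inner t) y.

Lemma odd_size_inner t : odd (size (inner t)) = false.
Proof.
elim: t => [|a b l IHl m IHm r IHr] //=.
by rewrite size_cat /= size_cat /= !addnS !oddS !oddD IHl IHm IHr.
Qed.

(** Pruning: the root edge alone serves l = 0; otherwise the root quadrilateral contributes a and b,
    and its three subtrees share the other l - 2 vertices. Being a subsequence of [inner t], the
    path repeats no vertex when t has none repeated. *)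
Lemma even_length_paths x y t l :
  valid x y t -> ~~ odd l -> l <= size (inner t) ->
  exists s, [/\ subseq s (inner t), size s = l & path e x (rcons s y)].
Proof.
elim: t x y l => [|a b l1 IH1 l2 IH2 l3 IH3] x y l.
  by move=> /= exy _; rewrite leqn0 => /eqP ->; exists [::]; rewrite /= exy.
move=> /= /and4P[exy v1 v2 v3]; case: l => [|[|l]] // ev_l lel.
  by exists [::]; rewrite sub0seq /= exy.
have [o1 o2 o3] : [/\ odd (size (inner l1)) = false,
    odd (size (inner l2)) = false & odd (size (inner l3)) = false].
  by rewrite !odd_size_inner.
move: lel; rewrite size_cat /= size_cat /= => lel.
have {}ev_l : ~~ odd l by move: ev_l; rewrite /= negbK.
have [k1 [k2 [k3 [def_l [le1 le2 le3] [e1 e2 e3]]]]] :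
  exists k1 k2 k3, [/\ l = k1 + k2 + k3,
     [/\ k1 <= size (inner l1), k2 <= size (inner l2) & k3 <= size (inner l3)]
   & [/\ ~~ odd k1, ~~ odd k2 & ~~ odd k3]].
  (* Fill the first subtree, then the second, and leave the rest to the third; all parts are even
     because every [inner] has even size. *)
  pose k1 := minn l (size (inner l1)); pose k2 := minn (l - k1) (size (inner l2)).
  by exists k1, k2, (l - k1 - k2); rewrite /k2 /k1; split; [lia|split; lia|split; lia].
have [s1 [ss1 sz1 p1]] := IH1 _ _ _ v1 e1 le1.
have [s2 [ss2 sz2 p2]] := IH2 _ _ _ v2 e2 le2.
have [s3 [ss3 sz3 p3]] := IH3 _ _ _ v3 e3 le3.
exists (s1 ++ a :: s2 ++ b :: s3); split.
- by apply: cat_subseq => //=; rewrite eqxx; apply: cat_subseq => //=; rewrite eqxx.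
- by rewrite size_cat /= size_cat /= sz1 sz2 sz3 def_l !addnS addnA.
rewrite rcons_cat rcons_cons rcons_cat rcons_cons -cat_rcons cat_path p1 last_rcons.
by rewrite -cat_rcons cat_path p2 last_rcons.
Qed.

Lemma leaf_edge x y p q t : valid x y t -> (p, q) \in leaves x y t -> e p q.
Proof.
elim: t x y => [|a b l IHl m IHm r IHr] x y /=.
  by move=> exy; rewrite inE => /eqP[-> ->].
case/and4P=> _ /IHl vl /IHm vm /IHr vr; rewrite !mem_cat.
by case/or3P=> [/vl|/vm|/vr].
Qed.

Lemma leaf_in_verts x y p q t :
  (p, q) \in leaves x y t -> (p \in verts x y t) && (q \in verts x y t).
Proof.
elim: t x y => [|a b l IHl m IHm r IHr] x y /=.
  by rewrite inE => /eqP[-> ->]; rewrite !inE !eqxx orbT.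
have vE c c' s k : (k \in verts c c' s) = [|| k == c, k == c' | k \in inner s].
  by rewrite inE mem_rcons inE.
rewrite !mem_cat => /or3P[/IHl|/IHm|/IHr]; rewrite !vE /= !mem_cat !inE !mem_cat !inE;
  by case/andP=> /or3P[->|->|->] /or3P[->|->|->]; rewrite ?orbT.
Qed.

(** The leaf {p, q} becomes the quadrilateral p, p', q', q, with r hung on its side {p', q'}. Leaves
    of r stay leaves, so gluing can go on from there. *)
Lemma graft x y t p q p' q' r :
  valid x y t -> (p, q) \in leaves x y t ->
  e p p' -> e q' q -> valid p' q' r ->
  exists t', [/\ valid x y t', perm_eq (verts x y t') (verts x y t ++ verts p' q' r)
              & {subset leaves p' q' r <= leaves x y t'}].
Proof.
move=> + + epp eqq vr; rewrite /verts.
suff: valid x y t -> (p, q) \in leaves x y t -> exists t', [/\ valid x y t',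
    perm_eq (inner t') (inner t ++ p' :: rcons (inner r) q')
    & {subset leaves p' q' r <= leaves x y t'}].
  move=> IH vt pq; have [t' [vt' pt' st']] := IH vt pq.
  exists t'; split=> //; apply/seq.permP => P; have /= := elimT seq.permP pt' P.
  by rewrite -!cats1 /= !count_cat /= !count_cat /= => ->; clear; lia.
elim: t x y => [|a b l1 IH1 l2 IH2 l3 IH3] x y.
  move=> /= exy; rewrite inE => /eqP[? ?]; subst p q; exists (Node p' q' Leaf r Leaf).
  split=> /=; first by rewrite exy epp vr eqq.
    by rewrite cats1.
  by move=> z z_r; rewrite inE mem_cat z_r orbT.
move=> /= /and4P[exy v1 v2 v3]; rewrite !mem_cat => /or3P[] pq.
- have [t' [v' p1 s']] := IH1 _ _ v1 pq; exists (Node a b t' l2 l3).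
  split=> /=; first by rewrite exy v' v2 v3.
    apply/seq.permP => P; have /= := elimT seq.permP p1 P.
    by rewrite !count_cat /= !count_cat => ->; clear; lia.
  by move=> z /s'; rewrite !mem_cat => ->.
- have [t' [v' p1 s']] := IH2 _ _ v2 pq; exists (Node a b l1 t' l3).
  split=> /=; first by rewrite exy v' v1 v3.
    apply/seq.permP => P; have /= := elimT seq.permP p1 P.
    by rewrite !count_cat /= !count_cat /= ?count_cat /= => ->; clear; lia.
  by move=> z /s'; rewrite !mem_cat => ->; rewrite orbT.
have [t' [v' p1 s']] := IH3 _ _ v3 pq; exists (Node a b l1 l2 t').
split=> /=; first by rewrite exy v' v1 v2.
  apply/seq.permP => P; have /= := elimT seq.permP p1 P.
  by rewrite !count_cat /= !count_cat /= ?count_cat /= => ->; clear; lia.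
by move=> z /s'; rewrite !mem_cat => ->; rewrite !orbT.
Qed.

End QuadTree.

Fixpoint quad_map (T U : Type) (f : T -> U) (t : quad_tree T) : quad_tree U :=
  if t is Node a b l m r
  then Node (f a) (f b) (quad_map f l) (quad_map f m) (quad_map f r) else Leaf.

Section QuadMap.
Variables (T U : eqType) (f : T -> U).
Implicit Types (x y : T) (t : quad_tree T).

Lemma inner_map t : inner (quad_map f t) = map f (inner t).
Proof.
by elim: t => [|a b l IHl m IHm r IHr] //=; rewrite IHl IHm IHr !map_cat /= map_cat.
Qed.

Lemma verts_map x y t : verts (f x) (f y) (quad_map f t) = map f (verts x y t).
Proof. by rewrite /verts inner_map /= map_rcons. Qed.

Lemma leaves_map x y t :
  leaves (f x) (f y) (quad_map f t) = [seq (f z.1, f z.2) | z <- leaves x y t].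
Proof.
by elim: t x y => [|a b l IHl m IHm r IHr] x y //=; rewrite IHl IHm IHr !map_cat.
Qed.

Lemma valid_map (e : rel T) (e' : rel U) x y t :
  {homo f : u v / e u v >-> e' u v} ->
  valid e x y t -> valid e' (f x) (f y) (quad_map f t).
Proof.
move=> fe; elim: t x y => [|a b l IHl m IHm r IHr] x y /=; first exact: fe.
by case/and4P=> /fe -> /IHl -> /IHm -> /IHr ->.
Qed.

End QuadMap.

(** * The hypercube *)

(** Formulated by a predicate instead of a subtype, so that the vertex set can shrink while paths
    stay in the same type. *)
Definition connected_on (T : finType) (e : rel T) (P : pred T) : Prop :=
  forall u v, P u -> P v -> connect [rel a b | [&& e a b, P a & P b]] u v.

Section ConnectedOn.
Variables (T : finType) (e : rel T).
Implicit Types (P R : pred T) (S : {set T}).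

(** The vertices lost from R to P are pairwise nonadjacent, so on a walk each one lies between two
    vertices of P and can be bypassed separately. *)
Lemma connected_on_detour P R :
  (forall x, P x -> R x) ->
  (forall x y, R x -> ~~ P x -> R y -> ~~ P y -> ~~ e x y) ->
  (forall x a b, R x -> ~~ P x -> P a -> P b -> e a x -> e x b ->
     connect [rel u v | [&& e u v, P u & P v]] a b) ->
  connected_on e R -> connected_on e P.
Proof.
move=> sPR indep detour conR u v Pu Pv.
have /connectP[p] := conR u v (sPR _ Pu) (sPR _ Pv).
(* Strong induction on the length, since bypassing a vertex consumes two steps of the walk. *)
have [m] := ubnP (size p); elim: m p u Pu => // m IHm [|x p] u Pu /=.
  by move=> _ _ ->.
rewrite ltnS => le_p /andP[/and3P[eux Ru Rx] p_p] def_v.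
have [Px|nPx] := boolP (P x).
  by apply: connect_trans (IHm _ _ Px le_p p_p def_v); apply: connect1; rewrite /= eux Pu.
case: p le_p p_p def_v => [|y p] /= le_p.
  by move=> _ def_v; rewrite -def_v Pv in nPx.
case/andP=> /and3P[exy _ Ry] p_p def_v.
have Py : P y by apply: contraLR exy; apply: indep.
by apply: connect_trans (IHm _ _ Py (ltnW le_p) p_p def_v); apply: detour exy.
Qed.

Lemma connected_on_induced P S :
  (forall x, P x -> x \notin S) -> connected_on e P ->
  connected_on (induced_minus e S) (fun u => P (val u)).
Proof.
move=> PS conP u v Pu Pv; have /connectP[p] := conP _ _ Pu Pv.
elim: p u Pu => [|x p IHp] u Pu /=; first by move=> _ /val_inj ->.
case/andP=> /and3P[eux _ Px] p_p def_v.
have := IHp (exist _ x (PS x Px)) Px p_p def_v.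
by apply/connect_trans/connect1; rewrite /= /induced_minus /= eux Pu.
Qed.

Lemma connected_on_all P : (forall x, P x) -> connected_on e P -> connected e.
Proof.
move=> allP conP u v; apply: connect_sub (conP u v (allP u) (allP v)) => a b /=.
by case/andP=> /connect1.
Qed.

End ConnectedOn.

Definition flip (n : nat) (x : 'rV['F_2]_n) (i : 'I_n) : 'rV['F_2]_n :=
  (x + delta_mx ord0 i)%R.

Section Cube.
Variable n : nat.
Implicit Types (x y z u v : 'rV['F_2]_n) (i j : 'I_n) (S D : {set 'rV['F_2]_n}).
Local Notation Q := (@hypercube n).

Lemma addF2 (a : 'F_2) : (a + a = 0)%R.
Proof. by case: a => [[|[|]]] // ?; apply/val_inj. Qed.

Lemma neqF2 (a b : 'F_2) : a != b -> b = (a + 1)%R.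
Proof. by case: a b => [[|[|]]] // ? [[|[|]]] // ? _; apply/val_inj. Qed.

Lemma addv_self x : (x + x = 0)%R.
Proof. by apply/rowP => i; rewrite !mxE addF2. Qed.

Lemma flipE x i j : flip x i ord0 j = (x ord0 j + (j == i)%:R)%R.
Proof. by rewrite !mxE eqxx. Qed.

Lemma flip_neq x i j : (flip x i ord0 j != x ord0 j) = (j == i).
Proof. by rewrite flipE -subr_eq0 addrC addKr; case: (j == i). Qed.

Lemma flip_out x i j : j != i -> flip x i ord0 j = x ord0 j.
Proof. by rewrite flipE => /negPf ->; rewrite addr0. Qed.

Lemma flipK x i : flip (flip x i) i = x.
Proof. by rewrite /flip -addrA addv_self addr0. Qed.

Lemma flipC x i j : flip (flip x i) j = flip (flip x j) i.
Proof. by rewrite /flip addrAC. Qed.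

Lemma flip_injr x : injective (flip x).
Proof. by move=> i j eq_ij; apply/eqP; rewrite -(flip_neq x) -eq_ij flip_neq eqxx. Qed.

Lemma hypercubeP x y : reflect (exists i, y = flip x i) (hypercube x y).
Proof.
apply: (iffP cards1P) => [[i def_i]|[i ->]]; exists i.
  apply/rowP => j; have := in_set1 j i; rewrite -def_i inE flipE.
  case: eqP => [-> <- | /eqP neq <-]; first by rewrite addr0.
  exact: neqF2.
by apply/setP => j; rewrite !inE eq_sym flip_neq.
Qed.

Lemma hypercube_flip x i : hypercube x (flip x i).
Proof. by apply/hypercubeP; exists i. Qed.

Lemma neighboursE x : [set y | hypercube x y] = flip x @: 'I_n.
Proof.
apply/setP => y; rewrite inE.
by apply/hypercubeP/imsetP => [[i ->]|[i _ ->]]; exists i.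
Qed.

Lemma card_neighbours x : #|[set y | hypercube x y]| = n.
Proof. by rewrite neighboursE card_imset ?card_ord //; apply: flip_injr. Qed.

(** Relative to a base point x, flips become boolean xor, so that comparisons of nearby points
    reduce to rewriting. *)
Lemma flip_xor x z i j :
  (flip z i ord0 j != x ord0 j) = (z ord0 j != x ord0 j) (+) (j == i).
Proof.
rewrite flipE; case: (j == i); last by rewrite addr0 addbF.
by case: (z _ _) (x _ _) => [[|[|]]] // ? [[|[|]]] // ?.
Qed.

Lemma hypercube_connected_on : connected_on Q predT.
Proof.
move=> x y _ _; have [m] := ubnP #|[set i | x ord0 i != y ord0 i]|.
elim: m x => // m IHm x; rewrite ltnS => le_m.
have [x_y|[i]] := set_0Vmem [set i | x ord0 i != y ord0 i].
  rewrite (_ : y = x) //; apply/rowP => i; apply/eqP; rewrite eq_sym.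
  by apply: contraFT (in_set0 i) => x_y_i; rewrite -x_y inE.
rewrite inE => xy_i; apply: connect_trans (IHm (flip x i) _).
  by apply: connect1; rewrite /= hypercube_flip.
apply: leq_trans le_m; apply/proper_card/properP; split.
  apply/subsetP => j; rewrite !inE flip_xor.
  by have [->|] := eqVneq j i; rewrite ?addbF // xy_i.
by exists i; rewrite !inE ?xy_i // flip_xor eqxx xy_i.
Qed.

End Cube.

(** * Perfect codes *)

(** Pigeonhole: with B the deleted vertices and A the labels of disjoint paths, some path is left
    intact. *)
Lemma exists_unattained (T U : finType) (f : T -> U) (A : {set U}) (B : {set T}) :
  #|B| < #|A| -> exists2 l, l \in A & forall z, z \in B -> f z != l.
Proof.
move=> ltBA; have [l lA lf] : exists2 l, l \in A & l \notin f @: B.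
  apply/subsetPn; apply: contraL ltBA => /subset_leq_card leA.
  by rewrite -leqNgt (leq_trans leA) ?leq_imset_card.
by exists l => // z zB; apply: contraNneq lf => <-; apply: imset_f.
Qed.

Section PerfectCode.
Variable n : nat.
Implicit Types (x y z u v : 'rV['F_2]_n) (i j l : 'I_n) (S X : {set 'rV['F_2]_n}).
Local Notation Q := (@hypercube n).

Lemma card_induced_neighbours S (u : {x | x \notin S}) :
  #|[set v | hypercube_minus S u v]| + #|[set v in S | Q (val u) v]| = n.
Proof.
rewrite -[RHS](card_neighbours (val u)) -[RHS](cardsID S) addnC; congr (_ + _).
  by apply: eq_card => v; rewrite !inE andbC.
rewrite -(card_imset _ val_inj); apply: eq_card => v; rewrite !inE andbC.
apply/imsetP/andP => [[w]|[Quv vS]]; first by rewrite inE => Quw ->; rewrite (valP w).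
by exists (exist _ v vS); rewrite ?inE.
Qed.

(** The case d = 1 turns regularity into exact domination, the form in which S enters the counts
    below. *)
Lemma regular_minusP S d : d < n ->
  regular (hypercube_minus S) (n - d) <->
  (forall u, u \notin S -> #|[set v in S | Q u v]| = d).
Proof.
move=> ltdn; split=> [regS u uS|domS u].
  have := card_induced_neighbours (exist _ u uS); rewrite regS /=; lia.
by have := card_induced_neighbours u; rewrite (domS _ (valP u)); lia.
Qed.

(** Double counting of the edges between S and its complement. *)
Lemma card_dominated S :
  (forall u, u \notin S -> #|[set v in S | Q u v]| = 1) ->
  #|~: S| = \sum_(v in S) #|[set u in ~: S | Q u v]|.
Proof.
move=> domS; rewrite -sum1_card (eq_bigr (fun u => \sum_(v in S | Q u v) 1)).
  rewrite (exchange_big_dep (mem S)) /=; last by move=> u v _ /andP[].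
  by apply: eq_bigr => v vS; rewrite -sum1_card; apply: eq_bigl => u; rewrite !inE vS.
move=> u; rewrite inE => /domS {1}<-; rewrite -sum1_card.
by apply: eq_bigl => v; rewrite inE.
Qed.

Lemma card_dominated_le S :
  (forall u, u \notin S -> #|[set v in S | Q u v]| = 1) -> #|~: S| <= n * #|S|.
Proof.
move/card_dominated->; rewrite mulnC -sum_nat_const; apply: leq_sum => v _.
rewrite -[X in _ <= X](card_neighbours v); apply/subset_leq_card/subsetP => u.
by rewrite !inE hypercube_sym => /andP[].
Qed.

Variable D : {set 'rV['F_2]_n}.
Hypothesis hD : PID Q D.

Lemma flip_notin x i : x \in D -> flip x i \notin D.
Proof.
move=> xD; have [indD _] := hD; apply: contraL (hypercube_flip x i) => fD.
exact: indD.
Qed.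

(** Two codewords at distance two would both dominate the vertex between them. *)
Lemma flip2_notin x i j : x \in D -> i != j -> flip (flip x i) j \notin D.
Proof.
move=> xD neq_ij; have [_ domD] := hD; apply/negP => yD.
have /cards1P[v def_v] : #|[set v in D | Q (flip x i) v]| == 1.
  by rewrite domD ?flip_notin.
have xv : x \in [set v] by rewrite -def_v inE xD hypercube_sym hypercube_flip.
have yv : flip (flip x i) j \in [set v] by rewrite -def_v inE yD hypercube_flip.
move: xv yv; rewrite !inE => /eqP -> /eqP def_x; move/negP: neq_ij; apply.
by have := flip_xor v (flip v i) j i; rewrite def_x eqxx flip_xor !eqxx; case: eqP.
Qed.

Lemma dominated x : x \notin D -> exists i, flip x i \in D.
Proof.
have [_ domD] := hD => /domD/eqP/cards1P[v def_v].
have : v \in [set v] by rewrite inE.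
by rewrite -def_v inE => /andP[vD /hypercubeP[i def_x]]; exists i; rewrite -def_x.
Qed.

Lemma PID_nonempty : exists x, x \in D.
Proof.
have [D0|[x xD]] := set_0Vmem D; last by exists x.
have [|i] := @dominated 0%R; first by rewrite D0 inE.
by exists (flip 0%R i).
Qed.

Lemma card_PID : #|~: D| = n * #|D|.
Proof.
have [_ domD] := hD; rewrite (card_dominated domD) mulnC -sum_nat_const.
apply: eq_bigr => v vD; rewrite -[RHS](card_neighbours v); apply: eq_card => u.
rewrite !inE [RHS]hypercube_sym andbC; case: hypercubeP => //= -[i def_v].
by rewrite -(flipK u i) -def_v flip_notin.
Qed.

(** The cube has at most (n + 1) |S| vertices by domination, and exactly (n + 1) |D| by
    [card_PID]. *)
Lemma PID_minimum S :
  (forall u, u \notin S -> #|[set v in S | Q u v]| = 1) -> #|D| <= #|S|.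
Proof.
move/card_dominated_le; have := cardsC D; have := cardsC S; rewrite card_PID.
by move=> <- eqD leS; rewrite -(leq_pmul2l (ltn0Sn n)) !mulSn eqD leq_add2l.
Qed.

(** A walk x + e_i, x, x + e_j through a codeword x is rerouted via x + e_i + e_j, at distance two
    from x. *)
Lemma connected_on_PID : connected_on Q [pred z | z \notin D].
Proof.
apply: connected_on_detour (@hypercube_connected_on n) => //=.
  by move=> x y _; rewrite !negbK => xD _ yD; have [indD _] := hD; apply: indD.
move=> x a b _; rewrite negbK => xD aD bD; rewrite hypercube_sym.
case/hypercubeP=> i def_a /hypercubeP[j def_b].
have [eq_ij|neq_ij] := eqVneq i j; first by rewrite def_a def_b eq_ij.
pose m := flip a j; have mD : m \notin D by rewrite /m def_a flip2_notin.
apply: (@connect_trans _ _ m); apply: connect1.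
  by rewrite /= aD mD hypercube_flip.
by rewrite /= mD bD /m def_a def_b flipC hypercube_sym hypercube_flip.
Qed.

End PerfectCode.

(** * Connectivity *)

Section Connectivity.
Variable n : nat.
Implicit Types (x y z u v : 'rV['F_2]_n) (i j l : 'I_n) (X : {set 'rV['F_2]_n}).
Local Notation Q := (@hypercube n).
Local Notation on P := [rel u v | [&& Q u v, P u & P v]].

Lemma connect_flip (P : pred 'rV['F_2]_n) u v i :
  P u -> P (flip u i) -> connect (on P) (flip u i) v -> connect (on P) u v.
Proof.
by move=> Pu Pf; apply/connect_trans/connect1; rewrite /= hypercube_flip Pu Pf.
Qed.

Variables (D : {set 'rV['F_2]_n}) (hD : PID Q D).

Section Detour.
Variables (X : {set 'rV['F_2]_n}) (x : 'rV['F_2]_n) (i j : 'I_n).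
Hypotheses (neq_ij : i != j) (xD : x \notin D) (xX : x \in X) (ltX : #|X| < n - 1).
Let P := [pred z | (z \notin D) && (z \notin X)].
Hypotheses (Pa : P (flip x i)) (Pb : P (flip x j)).

Lemma ltX1 : #|X :\ x| < n - 2.
Proof. by move: ltX; rewrite (cardsD1 x X) xX !ltn_subRL addnA. Qed.

(** The walk x + e_i, x, x + e_j is translated by e_l. If x + e_l is a codeword, the walk goes
    around it through x + e_i + e_j + e_l, at distance two from it. *)
Lemma column_detour l :
  l != i -> l != j ->
  flip (flip x i) l \notin D -> flip (flip x j) l \notin D ->
  (forall z, z ord0 l != x ord0 l ->
     (forall l', l' \notin [:: i; j; l] -> z ord0 l' = x ord0 l') -> z \notin X) ->
  connect (on P) (flip x i) (flip x j).
Proof.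
move=> li lj aD bD avoid.
have av z : z ord0 l != x ord0 l ->
     (forall l', l' \notin [:: i; j; l] -> (z ord0 l' != x ord0 l') = false) -> z \notin X.
  by move=> zl zo; apply: avoid => // l' /zo/eqP.
have aX : flip (flip x i) l \notin X.
  apply: av => [|l']; rewrite !flip_xor ?eqxx ?(negPf li) //.
  by rewrite !inE !negb_or => /and3P[/negPf -> _ /negPf ->].
have bX : flip (flip x j) l \notin X.
  apply: av => [|l']; rewrite !flip_xor ?eqxx ?(negPf lj) //.
  by rewrite !inE !negb_or => /and3P[_ /negPf -> /negPf ->].
have mX : flip x l \notin X.
  apply: av => [|l']; rewrite !flip_xor ?eqxx //.
  by rewrite !inE !negb_or => /and3P[_ _ /negPf ->].
have m'X : flip (flip (flip x i) j) l \notin X.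
  apply: av => [|l']; rewrite !flip_xor ?eqxx ?(negPf li) ?(negPf lj) //.
  by rewrite !inE !negb_or => /and3P[/negPf -> /negPf -> /negPf ->].
have step1 : P (flip (flip x i) l) by rewrite /= aD aX.
apply: (connect_flip Pa step1).
have step3 : P (flip (flip x j) l) by rewrite /= bD bX.
have last_step : connect (on P) (flip (flip x j) l) (flip x j).
  by apply: (@connect_flip _ _ _ l) => //; rewrite flipK.
have [mD|mD] := boolP (flip x l \in D).
  have m'D : flip (flip (flip x i) j) l \notin D.
    by rewrite (flipC (flip x i) j l) (flipC x i l) flip2_notin.
  have Pm' : P (flip (flip (flip x i) j) l) by rewrite /= m'D m'X.
  have m'i : flip (flip (flip (flip x i) j) l) i = flip (flip x j) l.
    by rewrite (flipC _ l i) (flipC _ j i) flipK.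
  apply: (@connect_flip _ _ _ j) => //; rewrite flipC //.
  by apply: (@connect_flip _ _ _ i); rewrite ?m'i.
have Pm : P (flip x l) by rewrite /= mD mX.
apply: (@connect_flip _ _ _ i) => //; rewrite flipC flipK //.
by apply: (@connect_flip _ _ _ j); rewrite 1?flipC.
Qed.

Definition out (A : pred 'I_n) z := [pick l | A l & z ord0 l != x ord0 l].

Lemma out_column (A : pred 'I_n) z l :
  A l -> z ord0 l != x ord0 l -> (forall l', A l' -> l' != l -> z ord0 l' = x ord0 l') ->
  out A z = Some l.
Proof.
rewrite /out => Al zl zo; case: pickP => [l' /andP[Al' zl']|/(_ l)].
  by congr Some; apply: contraNeq zl' => /(zo _ Al') ->.
by rewrite Al zl.
Qed.

(** Coordinate k separates z from x, so z in X would attain the label l. *)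
Lemma notin_of_label (f : 'rV['F_2]_n -> 'I_n) l z k :
  (forall v, v \in X :\ x -> f v != l) -> f z = l -> z ord0 k != x ord0 k -> z \notin X.
Proof.
move=> avoid fz zk; apply: contraL (eqxx l) => zX; rewrite -{1}fz avoid // !inE zX andbT.
by apply: contraNneq zk => ->.
Qed.

(** With two directions set aside, n - 2 labels face fewer than n - 2 vertices of X other than x. *)
Lemma card_setC2 k l : k != l -> #|X :\ x| < #|~: [set k; l]|.
Proof.
move=> neq_kl; have := cardsC [set k; l]; rewrite cards2 neq_kl card_ord => def_n.
by have := ltX1; rewrite -[X in _ < X - 2]def_n addKn.
Qed.

Lemma flip_notin_unique u k l : flip u k \in D -> l != k -> flip u l \notin D.
Proof. by move=> uD neq; rewrite -(flipK u k) flip2_notin // eq_sym. Qed.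

(* Let y = x + e_i + e_j.  Besides the path through x, cut by X, the disjoint
   paths are those through e_l-translates of x + e_i, x or y, and x + e_j and,
   when y is outside D, the one through y and one that combines the direction p
   leading from x + e_i to D with the direction q leading from x + e_j to D. The
   label [f] sends a vertex to the path it may lie on, so that some label is
   attained by no vertex of X other than x. *)
Lemma X_detour : connect (on P) (flip x i) (flip x j).
Proof.
have [yD|yD] := boolP (flip (flip x i) j \in D).
  (* The codeword y already dominates x + e_i and x + e_j, so no column is blocked by D at its ends.
     The default i is not among the labels sought. *)
  pose f z := odflt i (out [predC [:: i; j]] z).
  have [l] := exists_unattained f (card_setC2 neq_ij).
  rewrite !inE negb_or => /andP[li lj] avoid; apply: (@column_detour l) => //.
  - by apply: flip_notin_unique yD _.
  - by apply: flip_notin_unique (_ : flip (flip x j) i \in D) _; rewrite // flipC.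
  move=> z zl zo; apply: (notin_of_label avoid _ zl); rewrite /f (@out_column _ _ l _ zl) //.
    by rewrite !inE negb_or li.
  by move=> l'; rewrite !inE => Al' l'l; apply: zo; rewrite !inE orbA negb_or Al'.
have [/andP[aD aX] /andP[bD bX]] := (Pa, Pb).
have [p pD] := dominated hD aD; have [q qD] := dominated hD bD.
have pi : p != i by apply: contraNneq xD => pi; rewrite -(flipK x i) -{2}pi.
have pj : p != j by apply: contraNneq yD => <-.
have qj : q != j by apply: contraNneq xD => qj; rewrite -(flipK x j) -{2}qj.
have qi : q != i by apply: contraNneq yD => qi; rewrite flipC -qi.
(* Otherwise x + e_i + e_p and x + e_j + e_p would be codewords at distance two. *)
have pq : p != q.
  apply: contraL pD => /eqP->; have := flip2_notin hD qD neq_ij.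
  apply: contra => pD; rewrite (_ : flip _ j = flip (flip x i) q) //.
  by rewrite (flipC _ q i) (flipC _ q j) (flipC x j i) flipK.
(* Label j stands for the path through y, p for the combined path, any other l for its column; i and
   q are set aside. A point that differs from x only within i, j, q counts for the combined path
   exactly when it differs in q. *)
pose f z := if out [predC [:: i; j; q]] z is Some l then l
            else if z ord0 q != x ord0 q then p else j.
have iq : i != q by rewrite eq_sym.
have [l] := exists_unattained f (card_setC2 iq).
rewrite !inE negb_or => /andP[li lq] avoid.
have [lj|lj] := eqVneq l j.
  have Py : P (flip (flip x i) j).
    rewrite /= yD; apply: (@notin_of_label f l _ i) => //.
      rewrite lj /f /out; case: pickP => [l' /andP[]|_].
        by rewrite !inE !negb_or !flip_xor eqxx => /and3P[/negPf -> /negPf ->].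
      by rewrite !flip_xor eqxx (negPf qi) (negPf qj).
    by rewrite !flip_xor eqxx eqxx (negPf neq_ij).
  apply: (connect_flip Pa Py); apply: (@connect_flip _ _ _ i) => //.
    by rewrite flipC flipK.
  by rewrite flipC flipK.
have [lp|lp] := eqVneq l p; last first.
  apply: (@column_detour l) => //.
  - exact: flip_notin_unique pD _.
  - exact: flip_notin_unique qD _.
  move=> z zl zo; apply: (notin_of_label avoid _ zl); rewrite /f (@out_column _ _ l _ zl) //.
    by rewrite !inE !negb_or li lj.
  move=> l'; rewrite !inE !negb_or => /and3P[? ? _] l'l; apply: zo.
  by rewrite !inE !negb_or; apply/and3P.
subst l.
have Xp z : z ord0 p != x ord0 p ->
    (forall l', l' != i -> l' != j -> l' != q -> l' != p ->
       (z ord0 l' != x ord0 l') = false) ->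
    z \notin X.
  move=> zp zo; apply: (notin_of_label avoid _ zp); rewrite /f (@out_column _ _ p _ zp) //.
    by rewrite !inE !negb_or pi pj.
  move=> l'; rewrite !inE !negb_or => /and3P[? ? ?] l'l; apply/eqP.
  by rewrite -[_ == _]negbK zo.
(* The combined path starts at x + e_i and flips q, p, i, j, q, p in turn. Each intermediate vertex
   is at distance one or two from the codeword x + e_i + e_p or x + e_j + e_q, hence outside D. *)
have Pv1 : P (flip (flip x i) q).
  rewrite /= (flip_notin_unique pD) 1?eq_sym //.
  apply: (@notin_of_label f p _ q) => //.
    rewrite /f /out; case: pickP => [l' /andP[]|_].
      rewrite !inE !negb_or !flip_xor eqxx => /and3P[/negPf -> _ /negPf ->] //.
    by rewrite !flip_xor !eqxx (negPf qi).
  by rewrite !flip_xor !eqxx (negPf qi).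
have Pv2 : P (flip (flip (flip x i) q) p).
  rewrite /= flipC flip_notin //; apply: Xp => [|l' l'i l'j l'q l'p].
    by rewrite !flip_xor !eqxx (negPf pi) (negPf pq).
  by rewrite !flip_xor !eqxx (negPf l'i) (negPf l'p) (negPf l'q).
have Pv3 : P (flip (flip x q) p).
  rewrite /= -{1}(flipK x j) (flipC _ j q) flip2_notin 1?eq_sym //.
  apply: Xp => [|l' l'i l'j l'q l'p]; first by rewrite !flip_xor !eqxx (negPf pq).
  by rewrite !flip_xor !eqxx (negPf l'p) (negPf l'q).
have Pv4 : P (flip (flip (flip x j) q) p).
  rewrite /= flip_notin //; apply: Xp => [|l' l'i l'j l'q l'p].
    by rewrite !flip_xor !eqxx (negPf pj) (negPf pq).
  by rewrite !flip_xor !eqxx (negPf l'j) (negPf l'p) (negPf l'q).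
have Pv5 : P (flip (flip x j) p).
  rewrite /= (flip_notin_unique qD) //; apply: Xp => [|l' l'i l'j l'q l'p].
    by rewrite !flip_xor !eqxx (negPf pj).
  by rewrite !flip_xor !eqxx (negPf l'j) (negPf l'p).
apply: (connect_flip Pa Pv1); apply: (connect_flip Pv1 Pv2).
have v3 : flip (flip (flip (flip x i) q) p) i = flip (flip x q) p.
  by rewrite (flipC _ p i) (flipC _ q i) flipK.
have v4 : flip (flip (flip x q) p) j = flip (flip (flip x j) q) p.
  by rewrite (flipC _ p j) (flipC _ q j).
have v5 : flip (flip (flip (flip x j) q) p) q = flip (flip x j) p.
  by rewrite (flipC _ p q) flipK.
apply: (@connect_flip _ _ _ i); rewrite // v3 //.
apply: (@connect_flip _ _ _ j); rewrite // v4 //.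
apply: (@connect_flip _ _ _ q); rewrite // v5 //.
by apply: (@connect_flip _ _ _ p); rewrite // flipK.
Qed.

End Detour.

Lemma connected_on_minus X :
  #|X| < n - 1 -> connected_on Q [pred z | (z \notin D) && (z \notin X)].
Proof.
have [m] := ubnP #|X|; elim: m X => // m IHm X; rewrite ltnS => leX ltX.
have [X0|[x xX]] := set_0Vmem X.
  have := connected_on_PID hD; rewrite X0 => conD u v /= /andP[uD _] /andP[vD _].
  apply: connect_sub (conD u v uD vD) => a b /= /and3P[eab aD bD].
  by apply: connect1; rewrite /= eab aD bD !inE.
have eqX := cardsD1 x X; rewrite xX /= in eqX.
have {}IHm : connected_on Q [pred z | (z \notin D) && (z \notin X :\ x)].
  by apply: IHm; [move: leX | move: ltX]; rewrite eqX //; apply: ltnW.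
have only_x y :
    y \notin D -> y \notin X :\ x -> ~~ ((y \notin D) && (y \notin X)) -> y = x.
  move=> yD; rewrite yD !inE negbK => + yX; rewrite yX andbT negbK => /eqP.
  exact.
apply: connected_on_detour IHm => /= [z|y z|y a b].
- by rewrite !inE; case/andP=> -> /negPf ->; rewrite andbF.
- move=> /andP[yD yX] ynP /andP[zD zX] znP.
  by rewrite (only_x y yD yX ynP) (only_x z zD zX znP) hypercube_irr.
move=> /andP[yD yX] ynP Pa Pb; have yx := only_x y yD yX ynP.
have xD : x \notin D by rewrite -yx.
rewrite yx hypercube_sym => /hypercubeP[i def_a] /hypercubeP[j def_b].
have [eq_ij|neq_ij] := eqVneq i j; first by rewrite def_a def_b eq_ij.
by move: Pa Pb; rewrite def_a def_b; apply: (X_detour neq_ij xD xX ltX).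
Qed.

Lemma PID_k_connected : 0 < n -> k_connected (hypercube_minus D) (n - 1).
Proof.
move=> n_gt0; split=> [|X ltX].
  rewrite card_sig (eq_card (B := mem (~: D))) => [|z]; last by rewrite !inE.
  rewrite (card_PID hD); have [x xD] := PID_nonempty hD.
  have : 0 < #|D| by apply/card_gt0P; exists x.
  case: #|D| => // d _; rewrite mulnS.
  by apply: leq_trans (leq_addr _ _); rewrite subn1 prednK.
(* X is pushed forward to the cube, and connectivity is then pulled back through two nested
   subtypes: outside D, then outside X. *)
pose P := [pred z | (z \notin D) && (z \notin val @: X)].
have conP : connected_on Q P.
  by apply: connected_on_minus; rewrite card_imset //; apply: val_inj.
have PD z : P z -> z \notin D by case/andP.
have valX (u : {x | x \notin D}) : P (val u) = (u \notin X).
  by rewrite /= (valP u) (mem_imset _ _ val_inj).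
have := connected_on_induced PD conP.
have PX (u : {x | x \notin D}) : P (val u) -> u \notin X by rewrite valX.
move/(connected_on_induced PX)/connected_on_all; apply=> u.
by rewrite valX (valP u).
Qed.

End Connectivity.

(** * Spanning quadrangulations *)

(* Points of a subcube of directions a, b, c, d: [bits k] has coordinates along
   a, b, c, d the binary digits of k, least significant first.  A subcube with
   a base point outside D lacks either no point (del empty) or an antipodal pair
   of one of its two (a, b, c)-layers; the trees, found by computer search, are
   rooted at the edge {0, 8} in direction d and keep the edges {2, 10} and
   {3, 11} in direction d on their boundary. *)
Definition bits4 := (bool * bool * bool * bool)%type.

Definition bits (k : nat) : bits4 :=
  (odd k, odd k./2, odd k./2./2, odd k./2./2./2).

Definition xor4 (u v : bits4) : bits4 :=
  let: (u1, u2, u3, u4) := u in let: (v1, v2, v3, v4) := v in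
  (u1 (+) v1, u2 (+) v2, u3 (+) v3, u4 (+) v4).

Definition weight4 (u : bits4) : nat :=
  let: (u1, u2, u3, u4) := u in u1 + u2 + u3 + u4.

Definition adj4 (del : seq bits4) : rel bits4 := fun u v =>
  [&& weight4 (xor4 u v) == 1, u \notin del & v \notin del].

Definition spans_block (del : seq bits4) (t : quad_tree bits4) : bool :=
  let s := verts (bits 0) (bits 8) t in let ls := leaves (bits 0) (bits 8) t in
  [&& valid (adj4 del) (bits 0) (bits 8) t, uniq s,
      all (fun v => (v \in s) == (v \notin del)) (map bits (iota 0 16)),
      (bits 2, bits 10) \in ls & (bits 3, bits 11) \in ls].

Definition full_block_tree : quad_tree nat :=
  Node 2 10 Leaf Leaf (Node 14 12 Leaf Leaf (Node 13 9 Leaf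
    (Node 5 1 (Node 15 7 Leaf Leaf (Node 6 4 Leaf Leaf Leaf)) Leaf
      (Node 3 11 Leaf Leaf Leaf)) Leaf)).

Definition lower_block_tree : quad_tree nat :=
  Node 2 10 Leaf Leaf (Node 14 12 Leaf Leaf (Node 13 9
    (Node 4 5 Leaf Leaf (Node 7 15 Leaf (Node 3 11 Leaf Leaf Leaf) Leaf))
    Leaf Leaf)).

Definition upper_block_tree : quad_tree nat :=
  Node 2 10 (Node 4 6 (Node 1 5 Leaf Leaf (Node 13 12
    (Node 7 15 Leaf (Node 3 11 Leaf Leaf Leaf) Leaf) Leaf Leaf)) Leaf Leaf)
    Leaf Leaf.

Lemma full_block : spans_block [::] (quad_map bits full_block_tree).
Proof. by vm_compute. Qed.

Lemma lower_block : spans_block [:: bits 1; bits 6] (quad_map bits lower_block_tree).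
Proof. by vm_compute. Qed.

Lemma upper_block : spans_block [:: bits 9; bits 14] (quad_map bits upper_block_tree).
Proof. by vm_compute. Qed.

Section Bipancyclic.
Variable n : nat.
Implicit Types (x y z u v : 'rV['F_2]_n) (a b c d i j : 'I_n) (J : seq 'I_n).
Local Notation Q := (@hypercube n).

Variables (D : {set 'rV['F_2]_n}) (hD : PID Q D).
Let G : rel 'rV['F_2]_n := [rel u v | [&& Q u v, u \notin D & v \notin D]].

Definition agree_off J x z := [forall j, (j \notin J) ==> (z ord0 j == x ord0 j)].

Lemma agree_offP J x z :
  reflect (forall j, j \notin J -> z ord0 j = x ord0 j) (agree_off J x z).
Proof.
by apply: (iffP forall_inP) => agr j /agr => [/eqP|->].
Qed.

(* A spanning tree of quadrilaterals of the subcube of directions J through x,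
   rooted at the edge {x, x + e_d}, has an outer edge {y, y + e_d} along which
   one can pass to the neighbouring subcube in direction i. *)
Definition crossable d J x i := exists t,
  [/\ valid G x (flip x d) t, uniq (verts x (flip x d) t),
      verts x (flip x d) t =i [pred z | (z \notin D) && agree_off J x z]
    & exists y, [/\ (y, flip y d) \in leaves x (flip x d) t,
                    flip y i \notin D & flip (flip y d) i \notin D]].

Lemma eqF2 (p q r : 'F_2) : (q != p) = (r != p) -> q = r.
Proof.
by case: p q r => [[|[|]]] // ? [[|[|]]] // ? [[|[|]]] // ? _; apply/val_inj.
Qed.

Definition flip_if (m : bool) x i := if m then flip x i else x.

Lemma flip_if_xor m m' x i : flip_if m' (flip_if m x i) i = flip_if (m (+) m') x i.
Proof. by case: m m' => [] [] //=; rewrite flipK. Qed.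

Lemma flip_ifC m m' x i j : flip_if m' (flip_if m x i) j = flip_if m (flip_if m' x j) i.
Proof. by case: m m' => [] [] //=; rewrite flipC. Qed.

Lemma flip_ifE m x z i j :
  (flip_if m z i ord0 j != x ord0 j) = (z ord0 j != x ord0 j) (+) (m && (j == i)).
Proof. by case: m => /=; rewrite ?flip_xor // addbF. Qed.

(** * Four-dimensional blocks *)

Section Block.
Variables (a b c d : 'I_n).
Hypotheses (abcd : uniq [:: a; b; c; d]).

Definition shift x (s : bits4) : 'rV['F_2]_n :=
  let: (s1, s2, s3, s4) := s in
  flip_if s4 (flip_if s3 (flip_if s2 (flip_if s1 x a) b) c) d.

Lemma shiftD x (s t : bits4) : shift (shift x s) t = shift x (xor4 s t).
Proof.
case: s t => [[[s1 s2] s3] s4] [[[t1 t2] t3] t4] /=.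
rewrite (flip_ifC s4 t1) (flip_ifC s3 t1) (flip_ifC s2 t1) flip_if_xor.
rewrite (flip_ifC s4 t2) (flip_ifC s3 t2) flip_if_xor.
by rewrite (flip_ifC s4 t3) !flip_if_xor.
Qed.

Lemma shift_diff x (s t : bits4) : shift x t = shift (shift x s) (xor4 s t).
Proof.
rewrite shiftD; congr shift.
by case: s t => [[[s1 s2] s3] s4] [[[t1 t2] t3] t4]; rewrite /= !addKb.
Qed.

Let neqs : [/\ [/\ a != b, a != c & a != d], b != c, b != d & c != d].
Proof. by case/and4P: abcd; rewrite !inE !negb_or => /and3P[-> -> ->] /andP[-> ->] ->. Qed.

Definition coords x z : bits4 :=
  (z ord0 a != x ord0 a, z ord0 b != x ord0 b, z ord0 c != x ord0 c,
   z ord0 d != x ord0 d).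

Lemma shiftK x : cancel (shift x) (coords x).
Proof.
case=> [[[s1 s2] s3] s4]; rewrite /coords /shift !flip_ifE !eqxx.
have [[/negPf ab /negPf ac /negPf ad] /negPf bc /negPf bd /negPf cd] := neqs.
rewrite (eq_sym b a) (eq_sym c a) (eq_sym d a) (eq_sym c b) (eq_sym d b) (eq_sym d c).
by rewrite ab ac ad bc bd cd !andbF !andbT !addbF.
Qed.

Lemma agree_off_shift x (s : bits4) : agree_off [:: a; b; c; d] x (shift x s).
Proof.
apply/agree_offP => j; rewrite !inE !negb_or.
case/and4P=> /negPf ja /negPf jb /negPf jc /negPf jd.
case: s => [[[s1 s2] s3] s4]; apply/eqP; rewrite -[_ == _]negbK /shift !flip_ifE.
by rewrite ja jb jc jd eqxx !andbF.
Qed.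

Lemma coordsK x z : agree_off [:: a; b; c; d] x z -> shift x (coords x z) = z.
Proof.
move/agree_offP => agr; apply/rowP => j; apply: (@eqF2 (x ord0 j)).
have [[/negPf ab /negPf ac /negPf ad] /negPf bc /negPf bd /negPf cd] := neqs.
rewrite /shift !flip_ifE eqxx.
have [->|ja] := eqVneq j a; first by rewrite ab ac ad !andbF !andbT !addbF.
have [->|jb] := eqVneq j b; first by rewrite bc bd !andbF !andbT !addbF.
have [->|jc] := eqVneq j c; first by rewrite cd !andbF !andbT !addbF.
have [->|jd] := eqVneq j d; first by rewrite !andbF !andbT.
by rewrite (agr j) ?inE ?negb_or ?ja ?jb ?jc // eqxx !andbF.
Qed.

Lemma hypercube_shift x (s t : bits4) :
  weight4 (xor4 s t) == 1 -> Q (shift x s) (shift x t).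
Proof.
rewrite (shift_diff x s t); move: (xor4 s t) (shift x s) => m p.
by case: m => [[[[] []] []] []] // _; apply: hypercube_flip.
Qed.

Lemma shift_notin x (s t : bits4) :
  0 < weight4 (xor4 s t) <= 2 -> shift x s \in D -> shift x t \notin D.
Proof.
have [[ab ac ad] bc bd cd] := neqs.
rewrite (shift_diff x s t); move: (xor4 s t) (shift x s) => m p.
by case: m => [[[[] []] []] []] //= _ pD; (apply: flip2_notin || apply: flip_notin).
Qed.

Hypothesis abcD : forall z, (flip (flip (flip z a) b) c \in D) = (z \in D).

Lemma shift_abc x (s : bits4) : (shift x (xor4 s (bits 7)) \in D) = (shift x s \in D).
Proof. by rewrite -shiftD /= abcD. Qed.

Lemma crossable_of_table x del t i :
  (forall s, (shift x s \in D) = (s \in del)) ->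
  spans_block del t -> crossable d [:: a; b; c; d] x i.
Proof.
move=> delE /and5P[val_t uniq_t /allP all_t leaf2 leaf3].
have vertsE : verts x (flip x d) (quad_map (shift x) t)
               = map (shift x) (verts (bits 0) (bits 8) t).
  exact: (verts_map (shift x) (bits 0) (bits 8)).
have mem_leaves s : (s, xor4 s (bits 8)) \in leaves (bits 0) (bits 8) t ->
    (shift x s, flip (shift x s) d) \in leaves x (flip x d) (quad_map (shift x) t).
  move=> s_leaf; have := leaves_map (shift x) (bits 0) (bits 8) t.
  rewrite [shift x (bits 0)]/= [shift x (bits 8)]/= => ->.
  apply/mapP; exists (s, xor4 s (bits 8)) => //=; congr (_, _).
  by rewrite -shiftD.
exists (quad_map (shift x) t); split.
- apply: (@valid_map _ _ (shift x) (adj4 del) G (bits 0) (bits 8)) => // s s'.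
  by case/and3P=> adj ndel ndel'; rewrite /G /= !delE ndel ndel' hypercube_shift.
- by rewrite vertsE map_inj_uniq //; apply: can_inj (@shiftK x).
- move=> z; rewrite vertsE [RHS]inE; apply/mapP/andP => [[s s_t ->]|[zD agr]].
    rewrite agree_off_shift delE; split=> //; rewrite -(eqP (all_t s _)) //.
    by case: s {s_t} => [[[[] []] []] []]; vm_compute.
  exists (coords x z); rewrite ?coordsK //.
  rewrite (eqP (all_t _ _)) -?delE ?coordsK //.
  by case: (coords x z) => [[[[] []] []] []]; vm_compute.
have y2 := mem_leaves (bits 2) leaf2; have y3 := mem_leaves (bits 3) leaf3.
have [[ab ac ad] bc bd cd] := neqs.
set y := shift x (bits 2) in y2.
have {}y3 :
    (flip y a, flip (flip y a) d) \in leaves x (flip x d) (quad_map (shift x) t).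
  by move: y3; rewrite /y /= flipC.
have [/andP[good1 good2]|] := boolP ((flip y i \notin D) && (flip (flip y d) i \notin D)).
  by exists y.
(* A codeword on the translate of {y, y + e_d} by e_i is at distance one or two from both ends of
   the translate of the adjacent edge. *)
rewrite negb_and !negbK => bad; exists (flip y a); split=> //; case/orP: bad => yD.
- by rewrite flipC flip_notin.
- rewrite (_ : flip y a = flip (flip (flip y d) a) d) ?(flipC _ d i) 1?(flipC _ a i).
    by rewrite (flipC _ a d) flip2_notin // eq_sym.
  by rewrite (flipC _ a d) flipK.
- by rewrite (flipC _ d i) (flipC _ a i) flip2_notin.
by rewrite (flipC _ a d) (flipC _ a i) flip_notin.
Qed.

(** Every other point of the block is at distance one or two from u or from its translate by e_a +
    e_b + e_c. *)
Lemma deletedE x (u s : bits4) : u \in [:: bits 1; bits 9] -> shift x u \in D ->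
  (shift x s \in D) = (s \in [:: u; xor4 u (bits 7)]).
Proof.
move=> u19 uD; have vD : shift x (xor4 u (bits 7)) \in D by rewrite shift_abc.
apply/idP/idP => [|]; last by rewrite !inE => /orP[] /eqP ->.
move: uD vD (@shift_notin x u s) (@shift_notin x (xor4 u (bits 7)) s) => uD vD.
rewrite uD vD; move: (shift x s \in D) => b0; move: u19; clear.
rewrite !inE => /orP[] /eqP ->;
  case: b0; case: s => [[[[] []] []] []] // h1 h2 _;
  by [exact: (h1 isT isT) | exact: (h2 isT isT)].
Qed.

Lemma crossable_deleted x i :
  (flip x a \in D) || (flip (flip x a) d \in D) -> crossable d [:: a; b; c; d] x i.
Proof.
case/orP => xaD.
  apply: crossable_of_table lower_block => s; apply: deletedE => //.
by apply: crossable_of_table upper_block => s; apply: deletedE.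
Qed.

(** The points named in the hypotheses are half of the block; the other half are their translates by
    e_a + e_b + e_c, so the block misses D. *)
Lemma crossable_full x i :
  (forall j, j \in [:: a; b; c] -> (flip x j \notin D) && (flip (flip x j) d \notin D)) ->
  x \notin D -> flip x d \notin D -> crossable d [:: a; b; c; d] x i.
Proof.
move=> notD xD xdD; apply: crossable_of_table full_block => s; rewrite in_nil.
have half (m : bits4) : m \in [seq bits k | k <- [:: 0; 1; 2; 4; 8; 9; 10; 12]] ->
    shift x m \notin D.
  have [/andP[a1 a2] /andP[b1 b2] /andP[c1 c2]] :
      [/\ (flip x a \notin D) && (flip (flip x a) d \notin D),
          (flip x b \notin D) && (flip (flip x b) d \notin D)
        & (flip x c \notin D) && (flip (flip x c) d \notin D)].
    by split; apply: notD; rewrite !inE eqxx ?orbT.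
  by rewrite !inE; do 7?[case/predU1P=> [->|] //]; move/eqP->.
apply/negbTE.
have := half s; have := half (xor4 s (bits 7)); rewrite shift_abc; clear.
case: s => [[[[] []] []] []] h1 h2; by [exact: (h1 isT) | exact: (h2 isT)].
Qed.

End Block.

Lemma crossable_perm d J J' x i : J =i J' -> crossable d J x i -> crossable d J' x i.
Proof.
move=> eqJ [t [val_t uniq_t mem_t leaf_t]]; exists t; split=> // z.
by rewrite mem_t !inE; congr (_ && _); apply: eq_forallb => j; rewrite eqJ.
Qed.

(** Invariance under e_a + e_b + e_c is symmetric in a, b, c, so a direction leading from {x, x +
    e_d} to a codeword may be moved to the front; if there is none, the block misses D. *)
Lemma crossable_block a b c d x i :
  uniq [:: a; b; c; d] ->
  (forall z, (flip (flip (flip z a) b) c \in D) = (z \in D)) ->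
  x \notin D -> flip x d \notin D -> crossable d [:: a; b; c; d] x i.
Proof.
move=> abcd abcD xD xdD.
pose near j := (flip x j \in D) || (flip (flip x j) d \in D).
have [na|na] := boolP (near a); first exact: crossable_deleted.
have [nb|nb] := boolP (near b).
  apply: (@crossable_perm _ [:: b; a; c; d]) => [j|]; first by rewrite !inE orbCA.
  apply: crossable_deleted => // [|z]; last by rewrite (flipC z) abcD.
  move: abcd; rewrite /= !inE !negb_or eq_sym.
  by case/and4P=> /and3P[-> -> ->] /andP[-> ->] ->.
have [nc|nc] := boolP (near c).
  apply: (@crossable_perm _ [:: c; b; a; d]) => [j|].
    by rewrite !inE; do 3!case: eqP.
  apply: crossable_deleted => // [|z]; last first.
    by rewrite (flipC (flip z c)) (flipC z) (flipC _ c b) abcD.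
  move: abcd; rewrite /= !inE !negb_or (eq_sym c b) (eq_sym c a) (eq_sym b a).
  by case/and4P=> /and3P[-> -> ->] /andP[-> ->] ->.
apply: crossable_full => // j; rewrite -negb_or !inE.
by case/or3P=> /eqP ->.
Qed.
(** The first half spends its crossing edge on direction j. The second half is rooted at the
    translate of that edge, and its own crossing edge, chosen for i, survives the grafting. *)
Lemma crossable_cons d J j x i :
  d \in J -> j \notin J ->
  (forall y i', y \notin D -> flip y d \notin D -> crossable d J y i') ->
  x \notin D -> flip x d \notin D -> crossable d (j :: J) x i.
Proof.
move=> dJ jJ IH xD xdD.
have [t1 [val1 uniq1 mem1 [y [leaf_y yjD ydjD]]]] := IH x j xD xdD.
have /and3P[_ yD ydD] := leaf_edge val1 leaf_y.
have jd : j != d by apply: contraNneq jJ => ->.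
have y_t1 : y \in verts x (flip x d) t1 by case/andP: (leaf_in_verts leaf_y).
have agr_y : agree_off J x y by move: y_t1; rewrite mem1 inE => /andP[].
have [|t2 [val2 uniq2 mem2 [z [leaf_z ziD zdiD]]]] := IH (flip y j) i yjD.
  by rewrite flipC.
have [||t [val_t perm_t leaves_t]] := graft val1 leaf_y _ _ val2.
- by rewrite /G /= hypercube_flip yD.
- by rewrite /G /= (flipC y) hypercube_sym hypercube_flip ydjD.
have mem_verts w : w \in verts x (flip x d) t = (w \notin D) && agree_off (j :: J) x w.
  rewrite (perm_mem perm_t) mem_cat mem1 mem2 !inE -andb_orr; congr (_ && _).
  apply/orP/agree_offP => [[] /agree_offP agr l|agr].
  - by rewrite inE negb_or => /andP[_]; apply: agr.
  - rewrite inE negb_or => /andP[lj lJ]; rewrite agr // flip_out //.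
    exact: (agree_offP _ _ _ agr_y).
  have [wj|wj] := eqVneq (w ord0 j) (x ord0 j); [left | right]; apply/agree_offP => l lJ.
    by have [->|lj] := eqVneq l j; rewrite // agr // inE negb_or lj.
  have yj : y ord0 j = x ord0 j by apply: (agree_offP _ _ _ agr_y).
  have [->|lj] := eqVneq l j.
    by apply: (@eqF2 (x ord0 j)); rewrite flip_xor yj !eqxx wj.
  by rewrite flip_out // agr ?inE ?negb_or ?lj // (agree_offP _ _ _ agr_y).
exists t; split=> //; last first.
  by exists z; split=> //; apply: leaves_t.
rewrite (perm_uniq perm_t) cat_uniq uniq1 uniq2 andbT.
apply/hasPn => w; rewrite mem2 mem1 !inE => /andP[_ /agree_offP agr].
rewrite negb_and; apply/orP; right; apply/negP => /agree_offP agr'.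
have := flip_neq y j j.
by rewrite -(agr j jJ) (agr' j jJ) (agree_offP _ _ _ agr_y j jJ) !eqxx.
Qed.

Lemma crossable_cat a b c d (L : seq 'I_n) x i :
  (forall z, (flip (flip (flip z a) b) c \in D) = (z \in D)) ->
  uniq (L ++ [:: a; b; c; d]) ->
  x \notin D -> flip x d \notin D -> crossable d (L ++ [:: a; b; c; d]) x i.
Proof.
move=> abcD; elim: L x i => [|j L IHL] x i.
  by move=> abcd xD xdD; apply: crossable_block.
rewrite cat_cons cons_uniq => /andP[jL uniqL] xD xdD.
apply: crossable_cons => // [|y i' yD ydD]; last exact: IHL.
by rewrite mem_cat !inE eqxx !orbT.
Qed.

End Bipancyclic.

(** * Cycles *)

Lemma cycle_of_path (T : finType) (e : rel T) x y s :
  0 < size s -> path e x (rcons s y) -> e y x -> uniq (x :: rcons s y) ->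
  is_cycle e (y :: x :: s).
Proof.
move=> s_gt0 path_s eyx uniq_s; split=> //.
apply/andP; split; first by rewrite /= eyx.
by rewrite -(perm_uniq (permEl (perm_rcons y (x :: s)))).
Qed.

Section Lift.
Variables (T : finType) (e : rel T) (S : {set T}).

Lemma lift_seq (s : seq T) :
  {in s, forall x, x \notin S} -> exists s' : seq {x | x \notin S}, map val s' = s.
Proof.
elim: s => [|x s IHs] sS; first by exists [::].
have [|s' def_s] := IHs; first by move=> y y_s; apply: sS; rewrite inE y_s orbT.
by exists (exist _ x (sS x (mem_head x s)) :: s'); rewrite /= def_s.
Qed.

Lemma cycle_induced (c : seq {x | x \notin S}) :
  is_cycle e (map val c) -> is_cycle (induced_minus e S) c.
Proof.
rewrite /is_cycle /ucycle size_map (map_inj_uniq val_inj) => -[-> /andP[e_c ->]].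
split; rewrite ?andbT //; case: c e_c => //= x p.
by rewrite -map_rcons path_map.
Qed.
End Lift.

Lemma exists_notin n (s : seq 'I_n) : size s < n -> exists i, i \notin s.
Proof.
move=> lt_s; apply/existsP; apply: contraLR lt_s; rewrite negb_exists => /forallP all_s.
rewrite -leqNgt -{1}(card_ord n); apply: leq_trans (card_size s).
by apply/subset_leq_card/subsetP => i _; have := all_s i; rewrite negbK.
Qed.

(** * Cycles outside the code *)

Section Main.
Variable n : nat.
Local Notation Q := (@hypercube n).
Implicit Types (D : {set 'rV['F_2]_n}) (x y z u v : 'rV['F_2]_n).

(** The neighbour in D of x + e_a + e_b cannot be x + e_a or x + e_b. At x = 0 this produces
    codewords of weight three. *)
Lemma third_flip D (hD : PID Q D) x (a b : 'I_n) : x \in D -> a != b ->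
  exists c, [/\ c != a, c != b & flip (flip (flip x a) b) c \in D].
Proof.
move=> xD ab; have [c cD] := dominated hD (flip2_notin hD xD ab); exists c; split=> //.
  by apply: contraL cD => /eqP ->; rewrite flipC flipK flip_notin.
by apply: contraL cD => /eqP ->; rewrite flipK flip_notin.
Qed.

Lemma coset_triple D (d : 'I_n) : 3 < n -> coset_of_linear_PID D ->
  exists a b c, uniq [:: a; b; c; d] /\
    forall z, (flip (flip (flip z a) b) c \in D) = (z \in D).
Proof.
move=> n_gt3 [D0 [x0 [hD0 ->]]]; set E := [set y | y \in D0] in hD0.
have E0 : (0%R : 'rV['F_2]_n) \in E by rewrite inE mem0v.
have [a] : exists a, a \notin [:: d] by apply: exists_notin; apply: leq_trans n_gt3.
(* As e_a + e_d has a single neighbour in the linear code, reached in direction b', choosing b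
   different from b' keeps c from being d. *)
rewrite inE => ad; have [b' [_ _ b'E]] := third_flip hD0 E0 ad.
have [b] : exists b, b \notin [:: a; d; b'] by apply: exists_notin.
rewrite !inE !negb_or => /and3P[ba bd bb']; rewrite eq_sym in ba.
have [c [ca cb cE]] := third_flip hD0 E0 ba.
exists a, b, c; split.
  rewrite /= !inE !negb_or ba ad bd (eq_sym a) ca (eq_sym b) cb /= andbT.
  apply: contraTneq cE => ->; rewrite flipC.
  exact: (flip_notin_unique hD0 b'E bb').
move=> z; have memE y : (y \in [set (y + x0)%R | y in D0]) = ((y + x0)%R \in D0).
  apply/imsetP/idP => [[w wD0 ->]|yD0]; first by rewrite -addrA addv_self addr0.
  by exists (y + x0)%R; rewrite // -addrA addv_self addr0.
rewrite !memE; have -> : flip (flip (flip z a) b) c = (flip (flip (flip 0 a) b) c + z)%R.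
  by rewrite /flip add0r [RHS]addrC !addrA.
by rewrite -addrA rpredDl //; rewrite inE in cE.
Qed.

Lemma is_cycle_val D (c : seq {x | x \notin D}) (s : seq 'rV['F_2]_n) :
  map val c = s -> is_cycle Q s -> is_cycle (hypercube_minus D) c.
Proof. by move=> <-; apply: cycle_induced. Qed.

Lemma edge_bipancyclic_coset D (hD : PID Q D) :
  3 < n -> coset_of_linear_PID D -> edge_bipancyclic (hypercube_minus D).
Proof.
move=> n_gt3 cosD u v /hypercubeP[d def_v] l ev_l /andP[l_ge4].
rewrite card_sig => le_l.
have [a [b [c [abcd abcD]]]] := coset_triple d n_gt3 cosD.
(* With all remaining directions in L, the subcube is the whole of Q_n. *)
pose L := [seq j <- enum 'I_n | j \notin [:: a; b; c; d]].
have uniqL : uniq (L ++ [:: a; b; c; d]).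
  rewrite cat_uniq abcd filter_uniq ?enum_uniq // andbT.
  by apply/hasPn => j j_s; rewrite /= mem_filter j_s.
have fullL j : j \in L ++ [:: a; b; c; d].
  by rewrite mem_cat mem_filter mem_enum andbT; case: (j \in [:: a; b; c; d]).
have uD := valP u; have vD := valP v.
have xdD : flip (val u) d \notin D by rewrite -def_v.
have [t [val_t uniq_t mem_t _]] := crossable_cat hD a abcD uniqL uD xdD.
have {}mem_t w : w \in verts (val u) (val v) t = (w \notin D).
  rewrite def_v mem_t inE; case: (w \notin D) => //=.
  by apply/agree_offP => j; rewrite fullL.
have size_t : size (inner t) + 2 = #|[pred x | x \notin D]|.
  rewrite (eq_card (B := mem (verts (val u) (val v) t))) => [|w]; last by rewrite mem_t.
  rewrite def_v (card_uniqP _) // /verts /= size_rcons addn2 //.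
(* The ends u and v of the given edge account for two of the l vertices. *)
have [||s [sub_s size_s path_s]] := even_length_paths (l := l - 2) val_t.
- by move: ev_l l_ge4; clear; case: l => [|[|l]] //=; rewrite subn2 /= negbK.
- by rewrite leq_subLR addnC size_t.
have sub_verts : subseq (val u :: rcons s (val v)) (verts (val u) (val v) t).
  by rewrite /verts /= eqxx -!cats1; apply: cat_subseq.
have uniq_s : uniq (val u :: rcons s (val v)).
  by apply: subseq_uniq sub_verts _; rewrite def_v.
have [s' def_s] : exists s' : seq {x | x \notin D}, map val s' = s.
  apply: lift_seq => w w_s; rewrite -mem_t; apply: (mem_subseq sub_verts).
  by rewrite inE mem_rcons inE w_s !orbT.
exists (v :: u :: s'); split.
- apply: (@is_cycle_val _ _ (val v :: val u :: s)); first by rewrite /= def_s.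
  apply: cycle_of_path uniq_s.
  - by rewrite size_s subn_gt0 ltnW.
  - by rewrite def_v; apply: sub_path path_s => x y /and3P[].
  by rewrite hypercube_sym def_v hypercube_flip.
- rewrite /= -(size_map val s') def_s size_s; move: l_ge4; clear.
  by case: l => [|[|l]] //; rewrite subn2.
by split; rewrite ?inE ?eqxx ?orbT //=; right; rewrite eqxx.
Qed.

(** D consists of x and its antipode; the other six vertices, at distance one and two from x in
    alternation, form a hexagon. *)
Lemma hamiltonian_Q3 (n3 : n = 3) D (hD : PID Q D) : Hamiltonian (hypercube_minus D).
Proof.
have [x xD] := PID_nonempty hD.
have [a _] : exists a : 'I_n, a \notin [::] by apply: exists_notin; rewrite /= n3.
have [b] : exists b : 'I_n, b \notin [:: a] by apply: exists_notin; rewrite /= n3.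
rewrite inE eq_sym => ab; have [c [ca cb cD]] := third_flip hD xD ab.
pose s := [:: flip x a; flip (flip x a) b; flip x b; flip (flip x b) c; flip x c;
              flip (flip x c) a].
have sD : {in s, forall y, y \notin D}.
  move=> y; rewrite !inE => /or4P[| | |/or3P[]] /eqP ->; try exact: flip_notin.
  - by rewrite -(flipK (flip (flip x a) b) c) flip_notin.
  - by rewrite -(flipK (flip (flip x b) c) a) (flipC _ c a) (flipC x b a) flip_notin.
  - by rewrite -(flipK (flip (flip x c) a) b) (flipC x c a) (flipC _ c b) flip_notin.
have uniq_s : uniq s.
  apply: (@map_uniq _ _ (fun y =>
    (y ord0 a != x ord0 a, y ord0 b != x ord0 b, y ord0 c != x ord0 c))).
  rewrite /= !flip_xor !eqxx (eq_sym b a) (eq_sym a c) (eq_sym b c).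
  by rewrite (negPf ab) (negPf ca) (negPf cb).
have [s' def_s] := lift_seq sD.
have uniq_s' : uniq s' by rewrite -(map_inj_uniq val_inj) def_s.
exists s'.
  apply: is_cycle_val def_s _; split=> //; rewrite /ucycle uniq_s andbT /=.
  rewrite !hypercube_flip (flipC x a b) (flipC x b c) (flipC x c a).
  by rewrite !(hypercube_sym (flip (flip _ _) _)) !hypercube_flip.
move=> u; have eq_card_s' : #|s'| = #|{: {x | x \notin D}}|.
  rewrite (card_uniqP uniq_s') -(size_map val) def_s card_sig.
  rewrite (eq_card (B := mem (~: D))) => [|z]; last by rewrite !inE.
  (* From 4 |D| = 8 exactly six vertices lie outside D, so the hexagon exhausts them. *)
  have := cardsC D; rewrite (card_PID hD) card_mx card_Fp // mul1n [size s]/=.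
  move: #|D| => m; rewrite n3.
  by rewrite -mulSn -[2 ^ 3]/(4 * 2) => /eqP; rewrite eqn_pmul2l // => /eqP ->.
by rewrite (elimT (subset_cardP eq_card_s')) //; apply/subsetP.
Qed.

End Main.

Theorem theorem6p1 (k n : nat) (hk : 2 <= k) (hn : n = 2 ^ k - 1)
    (D : {set 'rV['F_2]_n}) (hD : PID (@hypercube n) D) :
  (regular (hypercube_minus D) (n - 1) /\
   k_connected (hypercube_minus D) (n - 1)) /\
  (coset_of_linear_PID D ->
   (k = 2 -> Hamiltonian (hypercube_minus D)) /\
   (3 <= k -> edge_bipancyclic (hypercube_minus D))) /\
  (forall S : {set 'rV['F_2]_n},
     regular (hypercube_minus S) (n - 1) ->
     k_connected (hypercube_minus S) (n - 1) ->
     #|D| <= #|S|).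
Proof.
have n_gt1 : 1 < n.
  have := leq_pexp2l (isT : 0 < 2) hk; rewrite hn; clear; case: (2 ^ k) => [|[|[|]]] //.
split; [split | split].
- by apply/regular_minusP => //; case: hD.
- by apply: PID_k_connected hD (ltnW n_gt1).
- move=> cosD; split=> [k2 | k_ge3].
    by apply: hamiltonian_Q3 hD; rewrite hn k2.
  apply: edge_bipancyclic_coset => //.
  have := leq_pexp2l (isT : 0 < 2) k_ge3; rewrite hn; clear.
  by case: (2 ^ k) => [|[|[|[|[|]]]]] // m _; rewrite subn1.
move=> S regS _; apply: PID_minimum => //.
by apply/regular_minusP.
Qed.
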